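(* For every $n\geq 1$, the map $\eta$ is a bijection from the set $\mathcal{A}_n$ of ascent sequences of length $n$ onto the set $\hat{\mathcal{B}}_{n+1}$ of revised ascent sequences of length $n+1$. In particular $|\hat{\mathcal{B}}_{n+1}|=|\mathcal{A}_n|$ is the $n$-th Fishburn number.
   Context: An endofunction of size $n$ is a word $x=x_1x_2\cdots x_n$ with $x_i\in[n]=\{1,\dots,n\}$. For such $x$, let $\mathrm{Asctop}(x)=\{1\}\cup\{i: 2\leq i\leq n,\ x_{i-1}<x_i\}$ and $\mathrm{Ascbot}(x)=\{1\}\cup\{i: 1\leq i\leq n-1,\ x_i<x_{i+1}\}$ (the index $1$ is always included), and let $\mathrm{asctop}(x)=|\mathrm{Asctop}(x)|$. An ascent sequence is an endofunction $x$ with $x_1=1$ and $1\leq x_i\leq \mathrm{asctop}(x_1\cdots x_{i-1})+1$ for all $2\leq i\leq n$; $\mathcal{A}_n$ is the set of ascent sequences of length $n$. A Cayley permutation is an endofunction $x$ containing every integer between $1$ and $\max(x)$; $\mathrm{Cay}_n$ is the set of these of length $n$. Let $\mathrm{Nub}(x)=\{\min x^{-1}(i): i\in \mathrm{Im}(x)\}$ be the set of indices of leftmost copies of values. The set of revised ascent sequences of length $n$ is $\hat{\mathcal{B}}_n=\{x\in\mathrm{Cay}_n : \mathrm{Ascbot}(x)=\mathrm{Nub}(x)\}$. The map $\eta$: given an ascent sequence $x$ with $\mathrm{Ascbot}(x)=\{a_1<a_2<\cdots<a_k\}$, for $i=a_1,a_2,\dots,a_k$ in this order, and for each $j=1,\dots,i-1$,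 if (the current value) $x_j\geq x_i$ then replace $x_j$ by $x_j+1$. Let $\tilde{x}$ be the resulting sequence; then $\eta(x)$ is the sequence of length $n+1$ obtained by prepending $\max(\tilde{x})$ to $\tilde{x}$. (For example $\eta(12132124)=545354124$.) The Fishburn numbers $1,2,5,15,53,\dots$ have generating function $\sum_{n\geq1}\prod_{i=1}^n(1-(1-x)^i)$. *)

(* Defs.v *)
From HB Require Import structures.
From mathcomp Require Import all_boot all_order all_algebra.
From mathcomp Require Import classical_sets functions cardinality.
Set Implicit Arguments.
Unset Strict Implicit.
Unset Printing Implicit Defensive.
Import GRing.Theory.

(* Words are of type [seq nat]; both letters and positions are numbered from 1,
   so [letter x i] is meaningful for 1 <= i <= size x. *)
Definition letter (x : seq nat) (i : nat) : nat := nth 0 x i.-1.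

Definition maxletter (x : seq nat) : nat := \max_(v <- x) v.

Definition endofunction (n : nat) (x : seq nat) : Prop :=
  size x = n /\ forall i, 1 <= i <= n -> 1 <= letter x i <= n.

(* Sets of positions are represented by duplicate-free lists.  Position 1 is put
   in front and [iota 2 _] enumerates the remaining candidates: 2, ..., size x
   for ascent tops and 2, ..., size x - 1 for ascent bottoms.  In particular
   both lists are strictly increasing. *)
Definition Asctop (x : seq nat) : seq nat :=
  1 :: [seq i <- iota 2 (size x).-1 | letter x i.-1 < letter x i].

Definition Ascbot (x : seq nat) : seq nat :=
  1 :: [seq i <- iota 2 (size x).-2 | letter x i < letter x i.+1].

Definition asctop (x : seq nat) : nat := size (Asctop x).

(* [index v x] is the 0-based position of the leftmost copy of v. *)
Definition Nub (x : seq nat) : seq nat := [seq (index v x).+1 | v <- undup x].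

Definition ascent_sequences (n : nat) : set (seq nat) :=
  [set x | [/\ endofunction n x,
               letter x 1 = 1 &
               forall i, 2 <= i <= n ->
                 1 <= letter x i <= (asctop (take i.-1 x)).+1]]%classic.

Definition Cay (n : nat) : set (seq nat) :=
  [set x | endofunction n x /\
           forall v, 1 <= v <= maxletter x -> v \in x]%classic.

Definition revised_ascent_sequences (n : nat) : set (seq nat) :=
  [set x | Cay n x /\ Ascbot x =i Nub x]%classic.

(* One round of the inner loop; [letter x i] itself is not modified, so the
   positions j < i may be updated simultaneously. *)
Definition eta_step (x : seq nat) (i : nat) : seq nat :=
  [seq if (j < i) && (letter x i <= letter x j) then (letter x j).+1
       else letter x j | j <- iota 1 (size x)].

(* The list of positions i is computed once, from the original word. *)
Definition eta_tilde (x : seq nat) : seq nat := foldl eta_step x (Ascbot x).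

Definition eta (x : seq nat) : seq nat :=
  maxletter (eta_tilde x) :: eta_tilde x.

Example eta_example :
  eta [:: 1; 2; 1; 3; 2; 1; 2; 4] = [:: 5; 4; 5; 3; 5; 4; 1; 2; 4].
Proof. by rewrite /eta /maxletter unlock. Qed.

Local Open Scope ring_scope.

(* Partial sums of the series  sum_(k >= 1) prod_(i = 1..k) (1 - (1 - x)^i). *)
Definition fishburn_partial (N : nat) : {poly int} :=
  \sum_(1 <= k < N.+1) \prod_(1 <= i < k.+1) (1 - (1 - 'X) ^+ i).

(* The k-th summand is divisible by x^k, so the coefficient of x^n in the formal
   power series is its coefficient in any partial sum of order N >= n
   (lemma [fishburn_stable]). *)
Definition fishburn (n : nat) : int := (fishburn_partial n)`_n.

Lemma fishburn_term_dvd (k : nat) :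
  exists q : {poly int},
    \prod_(1 <= i < k.+1) (1 - (1 - 'X) ^+ i) = q * 'X^k.
Proof.
elim: k => [|k [q IHk]]; first by exists 1; rewrite big_geq // mulr1.
rewrite big_nat_recr //= IHk -[X in X - _](expr1n _ k.+1) subrXX subKr.
set s := (X in 'X * X); exists (q * s).
by rewrite ['X * s]mulrC mulrACA -exprSr.
Qed.

Lemma fishburn_stable (n N : nat) :
  (n <= N)%N -> (fishburn_partial N)`_n = fishburn n.
Proof.
move=> le_nN; rewrite /fishburn /fishburn_partial.
rewrite (big_cat_nat _ (n := n.+1)) //= coefD [X in _ + X](_ : _ = 0) ?addr0 //.
rewrite coef_sum big_nat big1 // => k /andP[lt_nk _].
by have [q ->] := fishburn_term_dvd k; rewrite coefMXn lt_nk.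
Qed.

(* Main.v *)
(** Bijection.  Appending a letter [v] to an ascent sequence [x] with last
    letter [l] acts on [eta x] as follows.  If [v <= l], then [v] is appended to
    [eta x]; if [l < v], then first every letter [>= l] of [eta x] except the
    last one is increased by 1, which makes the last letter the only copy of
    [l].  The first letter of [eta x] is its maximum and equals [asctop x], so
    the allowed values [1 <= v <= asctop x + 1] are determined by [eta x], and
    every revised ascent sequence of length [> 2] arises from exactly one
    shorter one in this way.

    Counting.  Let [G(a, l)] be the generating function, by number of added
    letters, of the extensions of an ascent sequence with [asctop] equal to [a]
    and last letter [l].  It is the only power series solution of
      [G(a, l) = 1 + t (sum_(v <= l) G(a, v) + sum_(l < v <= a + 1) G(a + 1, v))].
    Put [q = 1 - t] and let [L] be the linear functional on power series in [s]
    with [L(s^j) = (1 - q) ... (1 - q^j)].  Since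
    [L((H(q s) - (1 - s) H(s)) / s) = H(0)] for all [H], a telescoping sum shows
    that [G(a, l) = L(1 / ((1 - s)^(a + 1 - l) (1 - q s)^l))] is that solution,
    and [t G(1, 1) = sum_(j >= 0) (1 - q) ... (1 - q^(j + 1))]. *)

Require Import Defs.
From mathcomp Require Import all_boot all_order all_algebra.
From mathcomp Require Import classical_sets functions cardinality.
From mathcomp Require Import ring zify.
Set Implicit Arguments.
Unset Strict Implicit.
Unset Printing Implicit Defensive.
Import GRing.Theory.

(** * Words extended by one letter *)

Lemma letter_rcons y v i : 0 < i <= size y -> letter (rcons y v) i = letter y i.
Proof. by case: i => // i /= lt_iy; rewrite /letter /= nth_rcons lt_iy. Qed.

Lemma letter_rcons_last y v : letter (rcons y v) (size y).+1 = v.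
Proof. by rewrite /letter /= nth_rcons ltnn eqxx. Qed.

Lemma letter_size y : letter y (size y) = last 0 y.
Proof. by rewrite /letter nth_last. Qed.

Lemma Asctop_rcons y v : 0 < size y ->
  Asctop (rcons y v)
    = Asctop y ++ (if last 0 y < v then [:: (size y).+1] else [::]).
Proof.
move=> y_gt0; rewrite /Asctop size_rcons succnK.
have -> : iota 2 (size y) = iota 2 (size y).-1 ++ [:: (size y).+1].
  by rewrite -{1}(prednK y_gt0) -(addn1 (size y).-1) iotaD add2n prednK.
rewrite filter_cat /= letter_rcons_last.
rewrite letter_rcons ?y_gt0 ?leqnn // letter_size; congr (_ :: (_ ++ _)).
apply: eq_in_filter => i; rewrite mem_iota => /andP[ge_i2 lt_im].
by rewrite !letter_rcons //; lia.
Qed.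

Lemma asctop_rcons y v : 0 < size y ->
  asctop (rcons y v) = asctop y + (last 0 y < v).
Proof.
by move=> y_gt0; rewrite /asctop Asctop_rcons // size_cat; case: (_ < _).
Qed.

Lemma Ascbot_rcons y v : 0 < size y ->
  Ascbot (rcons y v)
    = Ascbot y ++ (if (1 < size y) && (last 0 y < v) then [:: size y] else [::]).
Proof.
move=> y_gt0; rewrite /Ascbot size_rcons succnK.
have [y_gt1|y_le1] := ltnP 1 (size y); last first.
  by have -> : size y = 1 by lia.
have -> : iota 2 (size y).-1 = iota 2 (size y).-2 ++ [:: size y].
  have -> : (size y).-1 = (size y).-2 + 1 by lia.
  by rewrite iotaD addn1 /=; congr (iota 2 _ ++ [:: _]); lia.
rewrite filter_cat /= letter_rcons_last letter_rcons ?y_gt0 ?leqnn // letter_size.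
congr (_ :: (_ ++ _)).
apply: eq_in_filter => i; rewrite mem_iota => /andP[ge_i2 lt_im].
by rewrite !letter_rcons //; lia.
Qed.

(** As sets of positions the guard [1 < size y] disappears: when [size y = 1], position 1 belongs to
    [Ascbot y] by convention. *)
Lemma mem_Ascbot_rcons y v i : 0 < size y ->
  (i \in Ascbot (rcons y v))
    = (i \in Ascbot y) || (last 0 y < v) && (i == size y).
Proof.
move=> y_gt0; rewrite Ascbot_rcons // mem_cat.
case: ltnP => y_lt /=; last first.
  have -> : size y = 1 by lia.
  by rewrite in_nil orbF; case: eqP => [->|_]; rewrite ?andbF ?orbF // mem_head.
by case: (last 0 y < v); rewrite ?mem_seq1.
Qed.

Lemma Ascbot_bounds y i : 0 < size y -> i \in Ascbot y -> 0 < i <= size y.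
Proof.
move=> y_gt0; rewrite inE => /predU1P[->//|].
by rewrite mem_filter mem_iota; lia.
Qed.

Lemma Ascbot_rcons_bounds y v i : 0 < size y ->
  i \in Ascbot (rcons y v) -> 0 < i <= size y.
Proof.
move=> y_gt0; rewrite mem_Ascbot_rcons // => /orP[/Ascbot_bounds->//|].
by case/andP=> _ /eqP->; rewrite y_gt0 leqnn.
Qed.

Lemma Ascbot_map (f : nat -> nat) y :
  {mono f : a b / a < b} -> Ascbot (map f y) = Ascbot y.
Proof.
move=> f_mono; rewrite /Ascbot size_map; congr cons.
apply: eq_in_filter => i; rewrite mem_iota => /andP[ge_i2 lt_iy].
by rewrite /letter !(nth_map 0) ?f_mono //; lia.
Qed.

Lemma NubP x i : reflect (exists2 v, v \in x & i = (index v x).+1) (i \in Nub x).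
Proof.
by apply: (iffP mapP) => -[v v_x ->]; exists v; rewrite // mem_undup in v_x *.
Qed.

Lemma Nub_bounds x i : i \in Nub x -> 0 < i <= size x.
Proof. by case/NubP=> v v_x ->; rewrite /= index_mem. Qed.

Lemma mem_Nub_rcons y v i :
  (i \in Nub (rcons y v)) = (i \in Nub y) || (v \notin y) && (i == (size y).+1).
Proof.
apply/NubP/orP=> [[w]|].
  rewrite mem_rcons inE -cats1 index_cat; case: ifP => [w_y _ ->|w_y].
    by left; apply/NubP; exists w.
  rewrite orbF => /eqP w_v ->; right.
  by rewrite -w_v w_y /= w_v eqxx addn0.
case=> [/NubP[w w_y ->]|/andP[v_y /eqP->]].
  by exists w; rewrite ?mem_rcons ?inE ?w_y ?orbT // -cats1 index_cat w_y.
exists v; first by rewrite mem_rcons mem_head.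
by rewrite -cats1 index_cat (negPf v_y) /= eqxx addn0.
Qed.

Lemma Nub_map (f : nat -> nat) x : injective f -> Nub (map f x) = Nub x.
Proof.
move=> f_inj; rewrite /Nub undup_map_inj // -map_comp.
by apply: eq_map => v /=; rewrite index_map.
Qed.

(** The last position of a word of length at least 2 is never an ascent bottom, so it cannot carry a
    leftmost copy. *)
Lemma Ascbot_eq_Nub_rcons p l : 0 < size p ->
  (Ascbot (rcons p l) =i Nub (rcons p l))
  <-> (l \in p /\ Ascbot (rcons p l) =i Nub p).
Proof.
move=> p_gt0; split=> [eq_pl|[l_p eq_pl] i]; last first.
  by rewrite eq_pl mem_Nub_rcons l_p orbF.
have l_p : l \in p.
  apply/negPn/negP=> l_p; have := eq_pl (size p).+1.
  rewrite mem_Nub_rcons l_p eqxx orbT => /(Ascbot_rcons_bounds p_gt0).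
  by rewrite ltnn.
by split=> // i; rewrite eq_pl mem_Nub_rcons l_p orbF.
Qed.

Lemma Ascbot_eq_Nub_rcons_le y v : 0 < size y -> v <= last 0 y ->
  (Ascbot (rcons y v) =i Nub (rcons y v)) <-> (v \in y /\ Ascbot y =i Nub y).
Proof.
move=> y_gt0 le_v; rewrite Ascbot_eq_Nub_rcons //.
have eqA : Ascbot (rcons y v) =i Ascbot y.
  by move=> i; rewrite mem_Ascbot_rcons // ltnNge le_v orbF.
by split=> -[v_y eq_y]; split=> // i; rewrite -eq_y eqA.
Qed.

(** The ascent puts the position of [l] into [Ascbot], so [l] must be new there; cancelling that
    position on both sides leaves the condition of [Ascbot_eq_Nub_rcons] with [l \in p] turned into
    [l \notin p]. *)
Lemma Ascbot_eq_Nub_rcons_lt p l v : 0 < size p -> l < v ->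
  (Ascbot (rcons (rcons p l) v) =i Nub (rcons (rcons p l) v))
  <-> [/\ l \notin p, v \in p & Ascbot (rcons p l) =i Nub p].
Proof.
move=> p_gt0 lt_lv; rewrite Ascbot_eq_Nub_rcons ?size_rcons //.
rewrite mem_rcons inE gtn_eqF //=.
have memA i : i \in Ascbot (rcons (rcons p l) v) =
    (i \in Ascbot (rcons p l)) || (i == (size p).+1).
  by rewrite mem_Ascbot_rcons ?size_rcons // last_rcons lt_lv.
split=> [[v_p eq_pl]|[l_p v_p eq_pl]]; last first.
  by split=> // i; rewrite memA mem_Nub_rcons l_p eq_pl.
have l_p : l \notin p.
  apply/negP=> l_p; have := eq_pl (size p).+1.
  rewrite memA eqxx orbT mem_Nub_rcons l_p orbF => /esym/Nub_bounds.
  by rewrite ltnn.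
split=> // i; have := eq_pl i; rewrite memA mem_Nub_rcons l_p /=.
case: eqP => [->|_]; rewrite ?orbF // => _.
by apply/idP/idP=> [/(Ascbot_rcons_bounds p_gt0)|/Nub_bounds]; rewrite ltnn.
Qed.

(** * Relabelling by [bump l], which frees the value [l] *)

Lemma bump_lt l : {mono bump l : a b / a < b}.
Proof. by move=> a b; rewrite ltnNge leq_bump2 -ltnNge. Qed.

Lemma bump_inj l : injective (bump l).
Proof. exact: can_inj (bumpK l). Qed.

Lemma mem_map_bump l p v :
  (v \in map (bump l) p) = (v != l) && (unbump l v \in p).
Proof.
apply/mapP/andP=> [[a a_p ->]|[ne_vl v_p]].
  by rewrite bumpK eq_sym neq_bump.
by exists (unbump l v); rewrite ?unbumpK.
Qed.

(** Letters below [l] stay and letters [>= l] land above [l], so even the comparison with the final,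
    unbumped [l] is unchanged. *)
Lemma Ascbot_map_bump l p : 0 < size p ->
  Ascbot (rcons (map (bump l) p) l) =i Ascbot (rcons p l).
Proof.
move=> p_gt0 i; rewrite !mem_Ascbot_rcons ?size_map // Ascbot_map; last first.
  exact: bump_lt.
suff -> : (last 0 (map (bump l) p) < l) = (last 0 p < l) by [].
case: p p_gt0 => // a p _; rewrite /= last_map /bump; lia.
Qed.

(** * Growing revised ascent sequences *)

(* [M] is the largest letter of [w]. *)
Definition revised (w : seq nat) (M : nat) : Prop :=
  (forall v, (v \in w) = (1 <= v <= M)) /\ Ascbot w =i Nub w.

Definition grow (p : seq nat) (l v : nat) : seq nat :=
  rcons (rcons (if l < v then map (bump l) p else p) l) v.

Lemma revised_grow p l v M : 0 < size p -> 1 <= v <= M.+1 ->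
  revised (rcons p l) M -> revised (grow p l v) (M + (l < v)).
Proof.
move=> p_gt0 v_bnd [memM Rpl]; rewrite /grow.
have l_bnd : 1 <= l <= M by rewrite -memM mem_rcons mem_head.
case: ltnP => [lt_lv|le_vl] /=; last first.
  have v_in : v \in rcons p l by rewrite memM; lia.
  split; last by apply/Ascbot_eq_Nub_rcons_le; rewrite ?size_rcons ?last_rcons.
  by move=> x; rewrite mem_rcons inE addn0 -memM; case: eqP => // ->.
case/(Ascbot_eq_Nub_rcons _ p_gt0): Rpl => l_p Rpl.
(* Since [l] occurs in [p], the prefix alone has all the values; bumping turns them into [1..M+1]
   without [l], and the final [l] fills the gap. *)
have memp x : (x \in p) = (1 <= x <= M).
  by rewrite -memM mem_rcons inE; case: eqP => // ->.
split=> [x|].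
  by rewrite mem_rcons inE mem_rcons inE mem_map_bump memp /unbump; lia.
apply/Ascbot_eq_Nub_rcons_lt; rewrite ?size_map //.
split; first by rewrite mem_map_bump eqxx.
  by rewrite mem_map_bump memp /unbump; lia.
by move=> i; rewrite Ascbot_map_bump // Rpl Nub_map //; apply: bump_inj.
Qed.

Lemma revised_growP u M' : 2 < size u -> revised u M' ->
  exists p l v M,
    [/\ 0 < size p, u = grow p l v, revised (rcons p l) M & 1 <= v <= M.+1].
Proof.
case/lastP: u => // u v; case/lastP: u => // p l.
rewrite !size_rcons !ltnS => p_gt0 [memM Ru].
have v_bnd : 1 <= v <= M' by rewrite -memM mem_rcons mem_head.
have l_bnd : 1 <= l <= M' by rewrite -memM mem_rcons inE mem_rcons inE eqxx orbT.
case: (ltnP l v) => [lt_lv|le_vl]; last first.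
  exists p, l, v, M'; rewrite /grow (ltnNge l v) le_vl /=; split=> //; last lia.
  case/Ascbot_eq_Nub_rcons_le: Ru; rewrite ?size_rcons ?last_rcons // => v_in R.
  by split=> // x; rewrite -memM [RHS]mem_rcons inE; case: eqP => // ->.
case/(Ascbot_eq_Nub_rcons_lt p_gt0 lt_lv): Ru => l_p v_p R.
(* As [l] is absent from [p], closing the gap at [l] loses nothing, and [bump l] undoes it. *)
set p' := map (unbump l) p.
have def_p : map (bump l) p' = p.
  rewrite -map_comp map_id_in // => x x_p /=.
  by apply: unbumpK; rewrite inE; apply: contraNneq l_p => <-.
have p'_gt0 : 0 < size p' by rewrite size_map.
have memp x : (x \in p) = (x != l) && (1 <= x <= M').
  have := memM x; rewrite mem_rcons inE mem_rcons inE.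
  case: (eqVneq x l) => [->|ne_xl] /=; first by rewrite (negPf l_p).
  by case: eqP => [->|_] //=; rewrite v_p => <-.
have memp' x : (x \in p') = (1 <= x <= M'.-1).
  rewrite -(mem_map (@bump_inj l)) def_p memp eq_sym neq_bump /= /bump; lia.
exists p', l, v, M'.-1; rewrite /grow lt_lv def_p; split=> //; last lia.
split=> [x|].
  by rewrite mem_rcons inE memp'; lia.
apply/Ascbot_eq_Nub_rcons => //; split; first by rewrite memp'; lia.
move=> i; rewrite -Ascbot_map_bump // def_p R -def_p Nub_map //.
exact: bump_inj.
Qed.

(** The last two letters of the result are [l] and [v], so they reveal which branch was taken;
    [bump l] is injective. *)
Lemma grow_inj p l v p' l' v' :
  grow p l v = grow p' l' v' -> rcons p l = rcons p' l' /\ v = v'.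
Proof.
case/rcons_inj=> /rcons_inj[eq_p eq_l] eq_v; move: eq_p; rewrite -eq_l -eq_v.
by case: ifP => _ => [/(inj_map (@bump_inj l))|] ->.
Qed.

(** * The map eta *)

Lemma eta_step_rcons z v i : 0 < i <= size z ->
  eta_step (rcons z v) i = rcons (eta_step z i) v.
Proof.
move=> i_bnd; rewrite /eta_step size_rcons -(addn1 (size z)) iotaD map_cat cats1 /=.
rewrite add1n letter_rcons_last ltnNge leqW ?(andP i_bnd).2 //=.
congr rcons; apply/eq_in_map => j; rewrite mem_iota => /andP[j_gt0 j_le].
by rewrite !letter_rcons ?j_gt0.
Qed.

Lemma size_eta_step z i : size (eta_step z i) = size z.
Proof. by rewrite size_map size_iota. Qed.

Lemma eta_step_last z l :
  eta_step (rcons z l) (size z).+1 = rcons (map (bump l) z) l.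
Proof.
rewrite /eta_step size_rcons -[X in iota 1 X]addn1 iotaD map_cat cats1 /= add1n ltnn.
rewrite /= letter_rcons_last; congr rcons.
apply: (@eq_from_nth _ 0); rewrite !size_map size_iota // => j lt_jz.
rewrite !(nth_map 0) ?size_iota // nth_iota // add1n ltnS lt_jz /=.
by rewrite /letter nth_rcons lt_jz /bump; case: leqP.
Qed.

Lemma foldl_eta_step_rcons z v s : {in s, forall i, 0 < i <= size z} ->
  foldl eta_step (rcons z v) s = rcons (foldl eta_step z s) v.
Proof.
elim: s z => //= i s IHs z s_bnd.
rewrite eta_step_rcons ?s_bnd ?mem_head // IHs // => j j_s.
by rewrite size_eta_step s_bnd // inE j_s orbT.
Qed.

Lemma size_eta_tilde x : size (eta_tilde x) = size x.
Proof.
rewrite /eta_tilde; move: (Ascbot x) => s.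
by elim: s x => //= i s IHs x; rewrite IHs size_eta_step.
Qed.

(** A step at [i] reads and changes nothing beyond position [i], so the old steps ignore [v]; the
    only possible new step, at [size y], comes last. *)
Lemma eta_tilde_rcons y v : 0 < size y ->
  eta_tilde (rcons y v) =
  rcons (if last 0 y < v then eta_step (eta_tilde y) (size y) else eta_tilde y) v.
Proof.
move=> y_gt0; rewrite /eta_tilde Ascbot_rcons // foldl_cat.
rewrite foldl_eta_step_rcons; last by move=> i; apply: Ascbot_bounds.
rewrite -/(eta_tilde y).
have [y_gt1|y_le1] := ltnP 1 (size y).
  case: ltnP => //= _; rewrite eta_step_rcons // size_eta_tilde.
  by rewrite y_gt0 leqnn.
(* For [size y = 1] the list gets no second copy of position 1, but a step at position 1 has no
   [j < 1] to change. *)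
case: y y_gt0 y_le1 => [|a [|? ?]] //= _ _.
by case: ifP.
Qed.

Lemma last_eta_tilde y : last 0 (eta_tilde y) = last 0 y.
Proof.
case/lastP: y => // y v; case: y => // a y.
by rewrite eta_tilde_rcons // !last_rcons.
Qed.

Lemma maxletter_eq s m : m \in s -> {in s, forall v, v <= m} -> maxletter s = m.
Proof.
move=> m_s s_le; apply/eqP; rewrite eqn_leq; apply/andP; split.
  by apply/bigmax_leqP_seq => v v_s _; apply: s_le.
exact: (@leq_bigmax_seq _ s xpredT id).
Qed.

Lemma maxletter_in s : 0 < size s -> maxletter s \in s.
Proof.
elim: s => // a [|b s] IHs _; first by rewrite /maxletter big_seq1 mem_head.
rewrite /maxletter big_cons -/(maxletter _) inE.
by case: (leqP (maxletter (b :: s)) a) => [|_]; rewrite ?eqxx // IHs ?orbT.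
Qed.

Lemma revised_maxletter w M : 0 < size w -> revised w M -> maxletter w = M.
Proof.
move=> w_gt0 [memM _]; apply: maxletter_eq => [|v]; rewrite memM; last by case/andP.
case: w w_gt0 memM => // a w _ memM; have := memM a; rewrite mem_head; lia.
Qed.

Lemma eta_rcons y v M : 0 < size y -> revised (eta y) M -> v <= M.+1 ->
  exists p l, [/\ 0 < size p, eta y = rcons p l, l = last 0 y
                & eta (rcons y v) = grow p l v].
Proof.
move=> y_gt0 Ry le_v.
have maxM : maxletter (eta_tilde y) = M.
  rewrite -(revised_maxletter _ Ry) // /eta.
  rewrite [RHS]/maxletter big_cons -/(maxletter _); exact/esym/maxnn.
case: Ry => memM _; rewrite /eta maxM in memM *.
have := last_eta_tilde y; have := size_eta_tilde y.
case/lastP def_t: (eta_tilde y) => [|q l].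
  by move=> sz_y; rewrite -sz_y in y_gt0.
rewrite size_rcons last_rcons => sz_y def_l.
rewrite def_t in memM maxM.
exists (M :: q), l; split=> //.
rewrite eta_tilde_rcons // -def_l def_t -sz_y eta_step_last /grow.
have leM x : x \in rcons q l -> x <= M.
  by move=> x_ql; have := memM x; rewrite inE x_ql orbT; case/esym/andP.
have le_lM : l <= M by rewrite leM // mem_rcons mem_head.
have M_ql : M \in rcons q l.
  by rewrite -maxM maxletter_in // size_rcons.
case: ltnP => [lt_lv|le_vl] /=; congr (_ :: _).
  (* The prepended [M >= l] is bumped to [M.+1], which has to be the new maximum: if [M = l], then
     [l < v <= M.+1] forces [v = M.+1]; otherwise [M] occurs in [q] and is bumped. *)
  rewrite /bump le_lM add1n; apply: maxletter_eq => [|x].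
    rewrite mem_rcons inE mem_rcons inE mem_map_bump.
    move: M_ql; rewrite mem_rcons inE /unbump.
    case: eqP => [eq_Ml _|ne_Ml /= M_q].
      by apply/orP; left; apply/eqP; lia.
    have -> : M.+1 - (l < M.+1) = M by lia.
    by rewrite M_q; lia.
  rewrite mem_rcons inE mem_rcons inE => /or3P[/eqP->//|/eqP->|/mapP[b b_q ->]].
    exact: leqW.
  rewrite /bump; have := leM b; rewrite mem_rcons inE b_q orbT => /(_ isT); lia.
apply: maxletter_eq => [|x]; rewrite mem_rcons inE ?M_ql ?orbT //.
by case/predU1P=> [->|/leM//]; lia.
Qed.

(** * Generating functions *)

Section RecipCoef.
Local Open Scope ring_scope.
Variables (R : comNzRingType) (q : R).

(* Coefficient of [s^j] in [1 / ((1 - s)^p (1 - q s)^m)]. *)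
Fixpoint recip_coef (m p : nat) {struct m} : nat -> R :=
  if m is m'.+1 then
    fix coef j := if j is j'.+1 then recip_coef m' p j + q * coef j' else 1
  else fun j => ('C((j + p).-1, j))%:R.

(** The q-Pochhammer symbol [(q; q)_k], that is, the value [L(s^k)]. *)
Definition qfact (k : nat) : R := \prod_(1 <= i < k.+1) (1 - q ^+ i).

Lemma recip_coef0 m p : recip_coef m p 0 = 1.
Proof. by case: m => //=; rewrite bin0. Qed.

Lemma recip_coefSm m p j :
  recip_coef m.+1 p j.+1 = recip_coef m p j.+1 + q * recip_coef m.+1 p j.
Proof. by []. Qed.

(** Multiplication by [1 - s] lowers [p]: this is Pascal's rule for [m = 0], and it persists because
    the factors commute. *)
Lemma recip_coefSp m p j :
  recip_coef m p.+1 j.+1 = recip_coef m p j.+1 + recip_coef m p.+1 j.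
Proof.
elim: m j => [|m IHm] j.
  by rewrite /= -natrD !addnS /= -binS.
elim: j => [|j IHj].
  by rewrite !recip_coefSm IHm !recip_coef0; ring.
rewrite (recip_coefSm m p.+1 j.+1) IHm {1}IHj (recip_coefSm m p j.+1).
by rewrite (recip_coefSm m p.+1 j); ring.
Qed.

(** The substitution of [q s] for [s] turns [1/(1 - s)^m] into [1/(1 - q s)^m]. *)
Lemma recip_coef_qscale m j : recip_coef m 0 j = q ^+ j * recip_coef 0 m j.
Proof.
elim: m j => [|m IHm] [|j]; rewrite ?recip_coef0 ?expr0 ?mulr1 //.
  (* With [p = 0] the truncated predecessor gives ['C(j, j.+1) = 0], so the series is the constant
     1. *)
  by rewrite /= addn0 bin_small // mulr0.
elim: j => [|j IHj].
  by rewrite (recip_coefSm m 0 0) IHm (recip_coefSp 0 m 0) !recip_coef0; ring.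
by rewrite (recip_coefSm m 0 j.+1) IHj IHm (recip_coefSp 0 m j.+1) !exprS; ring.
Qed.

(* [1/(1-s) - 1/(1-qs) = (1-q) s / ((1-s)(1-qs))] *)
Lemma recip_coef_sub m p j :
  recip_coef m p.+1 j.+1 - recip_coef m.+1 p j.+1
    = (1 - q) * recip_coef m.+1 p.+1 j.
Proof.
have -> : recip_coef m.+1 p j.+1 =
    recip_coef m.+1 p.+1 j.+1 - recip_coef m.+1 p.+1 j.
  by rewrite recip_coefSp addrK.
by rewrite recip_coefSm; ring.
Qed.

Lemma qfactS k : qfact k.+1 = qfact k * (1 - q ^+ k.+1).
Proof. by rewrite /qfact big_nat_recr. Qed.

Lemma qfact0 : qfact 0 = 1.
Proof. by rewrite /qfact big_geq. Qed.

(* [G(a, l)], with [L] truncated at [s^N]; meaningful for [l <= a] only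
   (truncated subtraction). *)
Definition completion_gf (N a l : nat) : R :=
  \sum_(j < N.+1) qfact j * recip_coef l (a.+1 - l) j.

Arguments recip_coef : simpl never.

(** Split at [v = l]; by [recip_coef_sub] each half telescopes. The two ends at [l] combine to the
    first term on the right. The outer ends give the coefficient of [s^j] in
    [((1 - s) H(s) - H(q s)) / s] with [H = 1/(1 - s)^(a + 1)]. *)
Lemma completion_gf_coef_rec a l j : (l <= a)%N ->
  (1 - q) * \sum_(1 <= v < a.+2) recip_coef v ((a + (l < v)).+1 - v) j
    = recip_coef l (a.+1 - l) j
      + (1 - q ^+ j.+1) * recip_coef 0 a.+1 j.+1 - recip_coef 0 a.+1 j.
Proof.
move=> le_la.
rewrite big_add1 /= (big_cat_nat _ (n := l)) //=; last exact: leq_trans le_la _.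
rewrite mulrDr !mulr_sumr.
have -> : \sum_(0 <= m < l)
     (1 - q) * recip_coef m.+1 ((a + (l < m.+1)).+1 - m.+1) j
    = - \sum_(0 <= m < l)
     (recip_coef m.+1 (a - m.+1) j.+1 - recip_coef m (a - m) j.+1).
  rewrite -sumrN; apply: eq_big_nat => m /andP[_ lt_ml].
  rewrite ltnS leqNgt lt_ml addn0 opprB subSS.
  have lt_ma : (m < a)%N by apply: leq_trans le_la.
  by rewrite -(subnSK lt_ma) recip_coef_sub.
have -> : \sum_(l <= m < a.+1)
     (1 - q) * recip_coef m.+1 ((a + (l < m.+1)).+1 - m.+1) j
    = - \sum_(l <= m < a.+1)
     (recip_coef m.+1 (a.+1 - m.+1) j.+1 - recip_coef m (a.+1 - m) j.+1).
  rewrite -sumrN; apply: eq_big_nat => m /andP[le_lm lt_ma].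
  by rewrite ltnS le_lm addn1 opprB !subSS subSn // recip_coef_sub.
rewrite !telescope_sumr //; last exact: leq_trans le_la _.
rewrite subnn subn0 recip_coef_qscale subSn // (recip_coefSp l (a - l)).
by rewrite (recip_coefSp 0 a j); ring.
Qed.

(** The weight [qfact j] absorbs [1 - q ^+ j.+1] into [qfact j.+1], so the terms in [H] telescope;
    the last term is the truncation error. *)
Lemma completion_gf_rec N a l : (l <= a)%N ->
  1 + (1 - q) * \sum_(1 <= v < a.+2) completion_gf N (a + (l < v)) v
    = completion_gf N a l + qfact N.+1 * recip_coef 0 a.+1 N.+1.
Proof.
move=> le_la.
rewrite /completion_gf exchange_big /= mulr_sumr.
have -> : \sum_(j < N.+1) (1 - q) * \sum_(1 <= v < a.+2)
       qfact j * recip_coef v ((a + (l < v)).+1 - v) j =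
    \sum_(j < N.+1) (qfact j * recip_coef l (a.+1 - l) j +
     (qfact j.+1 * recip_coef 0 a.+1 j.+1 - qfact j * recip_coef 0 a.+1 j)).
  apply: eq_bigr => j _.
  by rewrite -mulr_sumr mulrCA completion_gf_coef_rec // qfactS; ring.
rewrite big_split /= -(big_mkord xpredT (fun j =>
  qfact j.+1 * recip_coef 0 a.+1 j.+1 - qfact j * recip_coef 0 a.+1 j)).
by rewrite telescope_sumr // qfact0 recip_coef0; ring.
Qed.

Lemma completion_gf11 N :
  (1 - q) * completion_gf N 1 1 = \sum_(1 <= k < N.+2) qfact k.
Proof.
rewrite /completion_gf big_add1 /= big_mkord mulr_sumr; apply: eq_bigr => j _.
rewrite mulrCA -recip_coef_sub recip_coef_qscale /recip_coef.
by rewrite addn1 /= binn mulr1 qfactS.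
Qed.

End RecipCoef.

(** * Specialization to [q = 1 - 'X] *)

Local Open Scope ring_scope.

(* Number of ways to append [k] letters to an ascent sequence with [asctop]
   equal to [a] and last letter [l]. *)
Fixpoint completions (k a l : nat) : nat :=
  if k is k'.+1 then (\sum_(1 <= v < a.+2) completions k' (a + (l < v)) v)%N
  else 1%N.

Lemma qfact_dvd k : exists p, qfact (1 - 'X : {poly int}) k = p * 'X^k.
Proof. exact: fishburn_term_dvd. Qed.

Lemma coef_completion_gf N k a l : (k <= N)%N -> (1 <= l <= a)%N ->
  (completion_gf (1 - 'X : {poly int}) N a l)`_k = (completions k a l)%:Z.
Proof.
move=> le_kN /andP[l_gt0 le_la].
elim: k a l le_kN l_gt0 le_la => [|k IHk] a l le_kN l_gt0 le_la.
  have := completion_gf_rec (1 - 'X : {poly int}) N le_la.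
  move/(congr1 (fun p : {poly int} => p`_0)).
  (* The truncation error is divisible by ['X^N.+1], hence invisible in degrees up to [N]. *)
  have [p ->] := qfact_dvd N.+1.
  by rewrite !coefD mulrAC coefMXn addr0 subKr coefXM coefC /= addr0.
have := completion_gf_rec (1 - 'X : {poly int}) N le_la.
move/(congr1 (fun p : {poly int} => p`_k.+1)).
have [p ->] := qfact_dvd N.+1.
(* Now [1 - q] is ['X], which shifts degrees by one and yields the recursion of [completions]. *)
rewrite !coefD mulrAC coefMXn ltnS le_kN addr0 subKr coefXM coefC /= add0r => <-.
rewrite coef_sum /= (big_morph Posz PoszD (erefl 0)).
apply: eq_big_nat => v /andP[v_gt0 le_va].
rewrite IHk //; first exact: ltnW.
case: ltnP => [_|le_vl]; first by rewrite addn1.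
by rewrite addn0 (leq_trans le_vl).
Qed.

Lemma completions_fishburn n : (completions n 1 1)%:Z = fishburn n.+1.
Proof.
rewrite -(coef_completion_gf (leqnn n)) //.
have := completion_gf11 (1 - 'X : {poly int}) n.
rewrite subKr => /(congr1 (fun p : {poly int} => p`_n.+1)).
by rewrite coefXM /= => ->.
Qed.

Local Close Scope ring_scope.

(** * Bijection and enumeration *)

Lemma revisedP n u :
  revised_ascent_sequences n u <-> size u = n /\ exists M, revised u M.
Proof.
split=> [[[[sz_u u_bnd] memM] Ru]|[sz_u [M [memM Ru]]]].
  split=> //; exists (maxletter u); split=> // v.
  apply/idP/idP => [v_u|/memM//]; apply/andP; split; last first.
    exact: (@leq_bigmax_seq _ u xpredT id).
  have := u_bnd (index v u).+1.
  by rewrite /letter /= nth_index // -sz_u index_mem v_u => /(_ isT)/andP[].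
(* The [M] distinct values need [M] positions, so the endofunction bound is automatic. *)
have le_Mn : M <= n.
  rewrite -(size_iota 1 M) -sz_u; apply: uniq_leq_size; first exact: iota_uniq.
  by move=> v; rewrite mem_iota memM add1n ltnS.
split=> //; split.
  split=> // i /andP[i_gt0 le_in].
  have : letter u i \in u by rewrite mem_nth // sz_u prednK.
  by rewrite memM => /andP[-> /leq_trans->].
move=> v v_bnd; case: u sz_u memM v_bnd {Ru} => [|a u] _ memM.
  by rewrite /maxletter big_nil; lia.
rewrite memM (@maxletter_eq _ M) // => [|x]; rewrite memM.
  by have := memM a; rewrite mem_head; lia.
by case/andP.
Qed.

Lemma asctop_le_size y : 0 < size y -> asctop y <= size y.
Proof.
move=> y_gt0; rewrite /asctop /= size_filter.
rewrite -[X in _ <= X](prednK y_gt0) ltnS.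
by rewrite -[X in _ <= X](size_iota 2) count_size.
Qed.

Lemma ascent_rcons n y v : 0 < n ->
  ascent_sequences n.+1 (rcons y v)
  <-> ascent_sequences n y /\ 1 <= v <= (asctop y).+1.
Proof.
move=> n_gt0; split.
  case=> -[]; rewrite size_rcons => -[sz_y] y_bnd y1 y_asc.
  split; last first.
    have := y_asc n.+1; rewrite ltnS n_gt0 leqnn -sz_y letter_rcons_last /=.
    by rewrite -cats1 take_size_cat // => ->.
  split.
  - split=> // i i_bnd; have := y_asc i; have := y_bnd i.
    rewrite !letter_rcons ?sz_y // => H1 H2.
    have [i_gt1|i_le1] := ltnP 1 i; last first.
      have -> : i = 1 by lia.
      by move: y1; rewrite letter_rcons ?sz_y // => ->.
    have le_in : i <= n.+1 by lia.
    have := H2; rewrite i_gt1 le_in => /(_ isT)/andP[-> le_yi] /=.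
    (* The hypothesis bounds letters only by [n.+1]; the bound [n] comes from [asctop] of a prefix
       of length [i.-1] being at most [i.-1]. *)
    apply: leq_trans le_yi _; rewrite -cats1 takel_cat; last by rewrite sz_y; lia.
    have sz_t : size (take i.-1 y) = i.-1 by rewrite size_takel // sz_y; lia.
    apply: leq_trans (_ : (size (take i.-1 y)).+1 <= _).
      by rewrite ltnS asctop_le_size // sz_t; lia.
    by rewrite sz_t; lia.
  - by move: y1; rewrite letter_rcons // sz_y.
  - move=> i i_bnd; have := y_asc i.
    rewrite letter_rcons ?sz_y; last lia.
    rewrite -cats1 takel_cat; last by rewrite sz_y; lia.
    by apply; lia.
case=> -[[sz_y y_bnd] y1 y_asc] v_bnd.
have le_an : asctop y <= n by rewrite -sz_y asctop_le_size // sz_y.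
split.
- split; first by rewrite size_rcons sz_y.
  move=> i i_bnd; have [le_in|gt_in] := leqP i n.
    by rewrite letter_rcons ?sz_y; have := y_bnd i; lia.
  have -> : i = (size y).+1 by lia.
  by rewrite letter_rcons_last; lia.
- by rewrite letter_rcons // sz_y.
- move=> i i_bnd; have [le_in|gt_in] := leqP i n.
    rewrite letter_rcons ?sz_y; last lia.
    rewrite -cats1 takel_cat; last by rewrite sz_y; lia.
    by apply: y_asc; lia.
  have -> : i = (size y).+1 by lia.
  by rewrite letter_rcons_last /= -cats1 take_size_cat.
Qed.

Lemma ascent1P x : ascent_sequences 1 x <-> x = [:: 1].
Proof.
split=> [[[]]|->]; first by case: x => [|a [|? ?]] //= _ _; rewrite /letter /= => ->.
split=> //; last by case=> [|[|]].
by split=> // -[|[|]].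
Qed.

Lemma ascent_rconsP n x : 0 < n -> ascent_sequences n.+1 x ->
  exists y v, [/\ x = rcons y v, ascent_sequences n y & 1 <= v <= (asctop y).+1].
Proof.
move=> n_gt0; case/lastP: x => [|y v]; first by case=> -[].
by move=> /(ascent_rcons _ _ n_gt0)[y_asc v_bnd]; exists y, v.
Qed.

Lemma revised2P u : revised_ascent_sequences 2 u <-> u = [:: 1; 1].
Proof.
split=> [/revisedP[]|->].
  case: u => [|a [|b [|? ?]]] // _ [M [memM]].
  rewrite -[[:: a; b]]/(rcons [:: a] b) => /Ascbot_eq_Nub_rcons[] // b_a _.
  move: b_a memM; rewrite mem_seq1 => /eqP-> memM.
  have := memM a; rewrite mem_head => a_bnd.
  by have := memM 1; rewrite !inE; case: eqP => [<-//|]; lia.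
apply/revisedP; split=> //; exists 1; split=> [v|].
  by rewrite !inE; lia.
by rewrite -[[:: 1; 1]]/(rcons [:: 1] 1); apply/Ascbot_eq_Nub_rcons.
Qed.

Lemma size_ascent n x : ascent_sequences n x -> size x = n.
Proof. by case=> -[]. Qed.

(** Tracking the maximum as [asctop x] makes the induction work: the letters allowed after [x] are
    then exactly those that [grow] accepts. *)
Lemma eta_revised n x : 0 < n -> ascent_sequences n x ->
  size (eta x) = n.+1 /\ revised (eta x) (asctop x).
Proof.
elim: n x => // -[_ x _ /ascent1P->|n IHn x _ /(@ascent_rconsP n.+1)].
  split=> //; have /revisedP[_ [M RM]] : revised_ascent_sequences 2 [:: 1; 1].
    exact/revised2P.
  have -> : eta [:: 1] = [:: 1; 1] by rewrite /eta /maxletter big_seq1.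
  have := @revised_maxletter [:: 1; 1] M isT RM.
  by rewrite /maxletter unlock /= => eqM; rewrite -eqM in RM.
case=> // y [v [-> y_asc v_bnd]]; have [sz_y Ry] := IHn y isT y_asc.
have y_gt0 : 0 < size y by rewrite (size_ascent y_asc).
split; first by rewrite /= size_eta_tilde size_rcons (size_ascent y_asc).
have [p [l [p_gt0 def_y def_l ->]]] := eta_rcons y_gt0 Ry (proj2 (andP v_bnd)).
rewrite asctop_rcons // -def_l; apply: revised_grow => //.
by rewrite -def_y.
Qed.

Lemma eta_injective n x x' : 0 < n ->
  ascent_sequences n x -> ascent_sequences n x' -> eta x = eta x' -> x = x'.
Proof.
elim: n x x' => // -[_ x x' _ /ascent1P-> /ascent1P->//|n IHn x x' _].
move=> /(@ascent_rconsP n.+1)[]// y [v [-> y_asc v_bnd]].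
move=> /(@ascent_rconsP n.+1)[]// y' [v' [-> y'_asc v'_bnd]].
have [_ Ry] := eta_revised (ltn0Sn n) y_asc.
have [_ Ry'] := eta_revised (ltn0Sn n) y'_asc.
have y_gt0 : 0 < size y by rewrite (size_ascent y_asc).
have y'_gt0 : 0 < size y' by rewrite (size_ascent y'_asc).
have [p [l [_ def_y _ ->]]] := eta_rcons y_gt0 Ry (proj2 (andP v_bnd)).
have [p' [l' [_ def_y' _ ->]]] := eta_rcons y'_gt0 Ry' (proj2 (andP v'_bnd)).
by case/grow_inj; rewrite -def_y -def_y' => /(IHn _ _ isT y_asc y'_asc) -> ->.
Qed.

Lemma eta_surjective n u : 0 < n -> revised_ascent_sequences n.+1 u ->
  exists2 x, ascent_sequences n x & eta x = u.
Proof.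
elim: n u => // -[_ u _ /revised2P->|n IHn u _ /revisedP[sz_u [M' Ru]]].
  by exists [:: 1]; [apply/ascent1P | rewrite /eta /maxletter big_seq1].
have [|p [l [v [M [p_gt0 def_u Rpl v_bnd]]]]] := revised_growP _ Ru.
  by rewrite sz_u.
have sz_pl : size (rcons p l) = n.+2.
  move: sz_u; rewrite def_u /grow !size_rcons => -[] <-.
  by case: ifP => _; rewrite ?size_map.
have [||y y_asc def_y] := IHn (rcons p l) => //.
  by apply/revisedP; split=> //; exists M.
have [_ Ry] := eta_revised (ltn0Sn n) y_asc.
have y_gt0 : 0 < size y by rewrite (size_ascent y_asc).
(* Both are the maximum of the same word, so the removed letter [v] is admissible after [y]. *)
have eqM : asctop y = M.
  rewrite -(revised_maxletter _ Ry) // def_y (revised_maxletter _ Rpl) //.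
  by rewrite size_rcons.
have v_asc : 1 <= v <= (asctop y).+1 by rewrite eqM.
exists (rcons y v); first exact/ascent_rcons.
have [p' [l' [_ def_y' _ ->]]] := eta_rcons y_gt0 Ry (proj2 (andP v_asc)).
by rewrite def_u; have [-> ->] := rcons_inj (etrans (esym def_y') def_y).
Qed.

Lemma eta_bij n : 0 < n ->
  set_bij (ascent_sequences n) (revised_ascent_sequences n.+1) eta.
Proof.
move=> n_gt0; split.
- move=> x x_asc; have [sz_x Rx] := eta_revised n_gt0 x_asc.
  by apply/revisedP; split=> //; exists (asctop x).
- by move=> x x'; rewrite !inE; apply: eta_injective.
- by move=> u /(eta_surjective n_gt0)[x x_asc <-]; exists x.
Qed.

(** * Enumeration of ascent sequences *)

(* The ascent sequences of length [n.+1]. *)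
Fixpoint ascent_words (n : nat) : seq (seq nat) :=
  if n is n'.+1 then
    [seq rcons y v | y <- ascent_words n', v <- iota 1 (asctop y).+1]
  else [:: [:: 1]].

Lemma ascent_wordsS n : ascent_words n.+1 =
  [seq rcons y v | y <- ascent_words n, v <- iota 1 (asctop y).+1].
Proof. by []. Qed.

Lemma mem_ascent_words n x : x \in ascent_words n <-> ascent_sequences n.+1 x.
Proof.
elim: n x => [|n IHn] x.
  by rewrite mem_seq1; split=> [/eqP/ascent1P|/ascent1P/eqP].
split=> [/allpairsPdep[y [v [/IHn y_asc v_bnd ->]]]|].
  apply/ascent_rcons => //; split=> //; move: v_bnd.
  by rewrite mem_iota add1n ltnS.
case/ascent_rconsP=> // y [v [-> y_asc v_bnd]]; apply/allpairsPdep.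
by exists y, v; split=> //; [apply/IHn | rewrite mem_iota add1n ltnS].
Qed.

Lemma ascent_words_uniq n : uniq (ascent_words n).
Proof.
elim: n => // n IHn; rewrite ascent_wordsS; apply: allpairs_uniq_dep => //.
  by move=> y _; apply: iota_uniq.
by move=> [y v] [y' v'] _ _ /= /rcons_inj[-> ->].
Qed.

(** Extensions of [[:: 1]] by [n + k] letters are grouped by their first [n] added letters; the
    induction moves one letter at a time from one count to the other. *)
Lemma sum_completions n k :
  \sum_(x <- ascent_words n) completions k (asctop x) (last 0 x)
    = completions (n + k) 1 1.
Proof.
elim: n k => [|n IHn] k; first by rewrite big_seq1.
rewrite addSnnS -IHn ascent_wordsS big_allpairs_dep; apply: eq_big_seq => y.
move/mem_ascent_words/size_ascent => sz_y.
rewrite [RHS]/= /index_iota subn1; apply: eq_bigr => v _.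
by rewrite asctop_rcons ?sz_y // last_rcons.
Qed.

Lemma size_ascent_words n : size (ascent_words n) = completions n 1 1.
Proof. by rewrite -[n in RHS]addn0 -sum_completions sum1_size. Qed.

Lemma ascent_card n :
  (ascent_sequences n.+1 #= `I_(size (ascent_words n)))%card.
Proof.
set s := ascent_words n.
have -> : ascent_sequences n.+1 = [set nth [::] s i | i in `I_(size s)]%classic.
  apply/seteqP; split=> x.
    move/mem_ascent_words => x_s.
    by exists (index x s); rewrite /= ?index_mem ?nth_index.
  by case=> i /= lt_is <-; apply/mem_ascent_words; rewrite mem_nth.
apply: inj_card_eq => i j; rewrite !inE /= => lt_is lt_js /eqP.
by rewrite nth_uniq ?ascent_words_uniq // => /eqP.
Qed.

Theorem mainTheorem1 (n : nat) (n_ge1 : 1 <= n) :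
  set_bij (ascent_sequences n) (revised_ascent_sequences n.+1) eta /\
  exists m : nat,
    [/\ (revised_ascent_sequences n.+1 #= `I_m)%card,
        (ascent_sequences n #= `I_m)%card &
        Posz m = fishburn n].
Proof.
have [eta_fun eta_inj eta_surj] := eta_bij n_ge1; split=> //.
case: n n_ge1 eta_fun eta_inj eta_surj => // n _ eta_fun eta_inj eta_surj.
exists (size (ascent_words n)); split; last 2 first.
- exact: ascent_card.
- by rewrite size_ascent_words completions_fishburn.
apply: card_eq_trans (ascent_card n).
suff -> : revised_ascent_sequences n.+2 = (eta @` ascent_sequences n.+1)%classic.
  exact: inj_card_eq.
by apply/seteqP; split=> [|_ [x x_asc <-]]; [exact: eta_surj | exact: eta_fun].
Qed.
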